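(* Formulation F6 is strictly tighter than Formulation F3 (both defined in the context). Explicitly, writing $X(S)_{t,m}=\sum_{t'=t-W_m+1}^{t}S_{t',m}$ for $t\in T$, $m\in M$: (i) for every instance $(T,M,(W_m)_{m\in M})$ and every continuous solution $S$ of F6, $X(S)$ is a continuous solution of F3; and (ii) there exist an instance and a continuous solution $X$ of F3 for that instance such that there is no continuous solution $S$ of F6 with $X(S)=X$.
   Context: An instance of the generator maintenance scheduling problem consists of a horizon $T=\{1,2,\dots,|T|\}$ of periods, a finite nonempty set $M$ of maintenances, and a positive integer duration $W_m$ for each $m\in M$. The variables are $X_{t,m}$ (maintenance $m$ is executed in period $t$) and $S_{t,m}$ (maintenance $m$ starts in period $t$), for $t\in T$, $m\in M$. Conventions: $X_{t,m}=0$ whenever $t\le 0$ or $t>|T|$; $S_{t,m}=0$ whenever $t\le 0$, $t>|T|$, or $t\ge |T|-W_m+2$ (a maintenance cannot start so late that it would not finish within the horizon). In particular every solution involving $S$ is required to satisfy $S_{t,m}=0$ for $t\in T$ with $t\ge |T|-W_m+2$. Formulation F3 (variables $X$ only): $\sum_{t\in T}X_{t,m}=W_m$ for all $m\in M$; $X_{t,m}-X_{t-1,m}\le X_{t+W_m-1,m}$ for all $t\in T$, $m\in M$; $X_{t,m}\in\{0,1\}$ for all $t\in T$, $m\in M$. Formulation F6 (variables $S$ only): $\sum_{t\in T}S_{t,m}=1$ for all $m\in M$; $S_{t,m}\in\{0,1\}$ for all $t\in T$, $m\in M$. In F6 the execution variable is not explicit: the expression $\sum_{t'=t-W_m+1}^{t}S_{t',m}$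 is used wherever $X_{t,m}$ would appear. A continuous solution of a formulation is a real assignment of its variables satisfying its linear relaxation, i.e. all its constraints with each condition ''$\in\{0,1\}$'' replaced by ''$\in[0,1]$''. A formulation A is at least as tight as B if all continuous solutions satisfying A also satisfy B; A is strictly tighter than B if A is at least as tight as B and there is at least one continuous solution satisfying B that does not satisfy A. The comparison is made in terms of $X$, with $X$ in F6 given by the expression above. *)

(* Defs.v *)
From HB Require Import structures.
From mathcomp Require Import all_boot all_order all_algebra.
From mathcomp Require Import reals.

Set Implicit Arguments.
Unset Strict Implicit.
Unset Printing Implicit Defensive.

Import Order.TTheory GRing.Theory Num.Theory.
Local Open Scope ring_scope.

Record instance := Instance {
  horizon : nat;
  maintenance : finType;
  duration : maintenance -> nat;
  maintenance_gt0 : (0 < #|maintenance|)%N;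
  duration_gt0 : forall m, (0 < duration m)%N }.

Definition assignment (R : realType) (I : instance) : Type :=
  'I_(horizon I) -> maintenance I -> R.

(* Periods are numbered from 1, ordinals from 0. *)
Definition period (n : nat) (t : 'I_n) : int := t.+1%:Z.

(* [at_period X t m] is X_{t,m} for an arbitrary integer t, with the convention
   X_{t,m} = 0 outside 1 <= t <= |T|. *)
Definition at_period (R : realType) (I : instance) (X : assignment R I)
    (t : int) (m : maintenance I) : R :=
  if t is Posz k.+1 then
    if insub k is Some i then X i m else 0
  else 0.

(* Formulations are parameterized by the domain of their variables: {0,1} gives
   the integer program, [0,1] its linear relaxation. *)
Definition formulation (R : realType) : Type :=
  forall I : instance, {pred R} -> assignment R I -> Prop.

Definition continuous_solution (R : realType) (F : formulation R)
    (I : instance) (V : assignment R I) : Prop :=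
  F I (mem `[0, 1]) V.

Definition F3 (R : realType) : formulation R :=
  fun (I : instance) (dom : {pred R}) (X : assignment R I) =>
  [/\ forall m, \sum_(t < horizon I) X t m = (duration m)%:R,
      forall t m,
        X t m - at_period X (period t - 1) m
          <= at_period X (period t + (duration m)%:Z - 1) m
    & forall t m, X t m \in dom].

(* The second clause says that a maintenance cannot start too late to finish
   within the horizon. *)
Definition F6 (R : realType) : formulation R :=
  fun (I : instance) (dom : {pred R}) (S : assignment R I) =>
  [/\ forall m, \sum_(t < horizon I) S t m = 1,
      forall t m,
        (horizon I)%:Z - (duration m)%:Z + 2 <= period t -> S t m = 0
    & forall t m, S t m \in dom].

(* The sum of S_{t',m} over t - W_m + 1 <= t' <= t, with t' = t - j. *)
Definition execution (R : realType) (I : instance) (S : assignment R I) :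
    assignment R I :=
  fun t m => \sum_(j < duration m) at_period S (period t - j%:Z) m.

(* Formulations are compared through the sets of X that their continuous
   solutions represent. *)
Definition X_region (R : realType) : Type :=
  forall I : instance, assignment R I -> Prop.

Definition F3_region (R : realType) : X_region R :=
  fun I X => continuous_solution (@F3 R) X.

Definition F6_region (R : realType) : X_region R :=
  fun I X => exists S : assignment R I,
    continuous_solution (@F6 R) S /\ execution S =2 X.

Definition at_least_as_tight (R : realType) (A B : X_region R) : Prop :=
  forall (I : instance) (X : assignment R I), A I X -> B I X.

Definition strictly_tighter (R : realType) (A B : X_region R) : Prop :=
  at_least_as_tight A B /\
  exists (I : instance) (X : assignment R I), B I X /\ ~ A I X.

(* Main.v *)
Require Import Defs.
From mathcomp Require Import all_boot all_order all_algebra.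
From mathcomp Require Import boolp reals.
From mathcomp Require Import lra zify.

(** Fix a maintenance of duration [w] in a horizon [n], and extend its start
    variables by zero to a sequence [a] indexed by all integers.  Its execution
    variables are then the sliding sums [a k + ... + a (k - w + 1)], written
    [window a w k] below, and everything in the inclusion of the two relaxations
    is a property of sliding sums.

    - Since no maintenance starts later than [n - w + 1], every start is counted
      by exactly [w] of the windows ending in the horizon, so the total execution
      time is [w] times the total start weight [1] ([sum_window]).
    - Two consecutive windows differ by [a t - a (t - w)], at most [a t] because
      [a] is nonnegative ([window_sub_le]); and [a t] is itself the oldest term of
      the window ending at [t + w - 1] ([le_window_last]).  If that window ends after
      the horizon, then [t] is too late for a start and [a t = 0].
    - A window is a part of the total start weight, hence lies in [0, 1]
      ([window_le_sum]).

    The inclusion is strict already for one maintenance of duration [2] in a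
    horizon of [3] periods.  Period 1 can only execute a start in period 1, and
    period 3 a start in period 2 or 3, so the execution variables of periods 1 and
    3 add up to the total start weight [1].  The constant execution [2/3]
    satisfies the relaxation in terms of executions, but gives [4/3] here. *)

Set Implicit Arguments.
Unset Strict Implicit.
Unset Printing Implicit Defensive.

Import Order.TTheory GRing.Theory Num.Theory.
Local Open Scope ring_scope.

Definition window (R : nmodType) (a : int -> R) (w : nat) (k : int) : R :=
  \sum_(j < w) a (k - j%:Z).

Lemma window_recl (R : nmodType) (a : int -> R) (w : nat) (k : int) :
  window a w.+1 k = a k + window a w (k - 1).
Proof.
rewrite /window big_ord_recl subr0; congr (_ + _).
by apply: eq_bigr => j _; congr a; rewrite lift0; lia.
Qed.

Lemma window_recr (R : nmodType) (a : int -> R) (w : nat) (k : int) :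
  window a w.+1 k = window a w k + a (k - w%:Z).
Proof. by rewrite /window big_ord_recr. Qed.

Lemma window_ge0 (R : numDomainType) (a : int -> R) (w : nat) (k : int) :
  (forall i, 0 <= a i) -> 0 <= window a w k.
Proof. by move=> a_ge0; apply: sumr_ge0. Qed.

Lemma window_eq0 (R : nmodType) (a : int -> R) (w : nat) (k : int) :
  (forall i : int, i <= 0 -> a i = 0) -> k <= 0 -> window a w k = 0.
Proof. by move=> a_le0 k_le0; apply: big1 => j _; apply: a_le0; lia. Qed.

(** Splitting off either end of the window of length [w + 1] ending at [k] gives
    [a k + window a w (k - 1) = window a w k + a (k - w)]. *)
Lemma window_sub_le (R : numDomainType) (a : int -> R) (w : nat) (k : int) :
  (forall i, 0 <= a i) -> window a w k - window a w (k - 1) <= a k.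
Proof.
move=> a_ge0; rewrite lerBlDr -window_recl window_recr.
by rewrite lerDl.
Qed.

Lemma le_window_last (R : numDomainType) (a : int -> R) (w : nat) (k : int) :
  (forall i, 0 <= a i) -> (0 < w)%N -> a k <= window a w (k + w%:Z - 1).
Proof.
case: w => // w a_ge0 _.
have e : k + w.+1%:Z - 1 - w%:Z = k by lia.
by rewrite window_recr e lerDr window_ge0.
Qed.

Lemma window_le_sum (R : numDomainType) (a : int -> R) (w k : nat) :
  (forall i, 0 <= a i) -> (forall i : int, i <= 0 -> a i = 0) ->
  window a w k%:Z <= \sum_(i < k) a i.+1%:Z.
Proof.
move=> a_ge0 a_le0; elim: k w => [|k IHk] [|w].
- by rewrite /window !big_ord0.
- by rewrite window_eq0 // big_ord0.
- by rewrite /window big_ord0 sumr_ge0.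
rewrite window_recl big_ord_recr /= addrC lerD2r.
by have -> : k.+1%:Z - 1 = k%:Z by lia.
Qed.

(** Shifting by one period moves only the two end terms of the sum in or out of
    the horizon, and both vanish as long as the shift stays below [w]. *)
Lemma sum_shift (R : zmodType) (a : int -> R) (n w j : nat) :
  (forall i : int, i <= 0 -> a i = 0) ->
  (forall i : int, n%:Z - w%:Z + 2 <= i -> a i = 0) ->
  (j < w)%N ->
  \sum_(t < n) a (t.+1%:Z - j%:Z) = \sum_(t < n) a t.+1%:Z.
Proof.
move=> a_le0 a_late; elim: j => [|j IHj] ltjw.
  by apply: eq_bigr => t _; rewrite subr0.
rewrite -IHj; last by lia.
have step (t : 'I_n) : a (t.+1%:Z - j.+1%:Z) = a (t%:Z - j%:Z).
  by congr a; lia.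
under eq_bigr => t _ do rewrite step.
apply/esym/eqP; rewrite -subr_eq0 -sumrB.
rewrite -(big_mkord xpredT (fun t => a (t.+1%:Z - j%:Z) - a (t%:Z - j%:Z))).
rewrite (telescope_sumr (fun t : nat => a (t%:Z - j%:Z))) //.
by rewrite a_late ?a_le0 ?subrr //; lia.
Qed.

Lemma sum_window (R : zmodType) (a : int -> R) (n w : nat) :
  (forall i : int, i <= 0 -> a i = 0) ->
  (forall i : int, n%:Z - w%:Z + 2 <= i -> a i = 0) ->
  \sum_(t < n) window a w t.+1%:Z = (\sum_(t < n) a t.+1%:Z) *+ w.
Proof.
move=> a_le0 a_late; rewrite exchange_big /=.
under eq_bigr => j _ do rewrite (sum_shift a_le0 a_late (ltn_ord j)).
by rewrite sumr_const card_ord.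
Qed.

Lemma at_period_le0 (R : realType) (I : instance) (X : assignment R I) k m :
  k <= 0 -> at_period X k m = 0.
Proof. by case: k => [[|k]|k]. Qed.

Lemma at_period_gt (R : realType) (I : instance) (X : assignment R I) k m :
  (horizon I)%:Z < k -> at_period X k m = 0.
Proof. by case: k => [[|k]|k] //= lt_nk; rewrite insubF //; lia. Qed.

Lemma at_period_period (R : realType) (I : instance) (X : assignment R I)
    (t : 'I_(horizon I)) m :
  at_period X (period t) m = X t m.
Proof. by rewrite /= valK. Qed.

(** Phrased as an eliminator, so that a property of the extension by zero reduces
    to the periods themselves, where the hypotheses on assignments apply. *)
Lemma at_period_ind (R : realType) (I : instance) (X : assignment R I) m
    (P : int -> R -> Prop) :
  (forall t, P (period t) (X t m)) ->
  (forall k, (k <= 0) || ((horizon I)%:Z < k) -> P k 0) ->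
  forall k, P k (at_period X k m).
Proof.
move=> Pin Pout k; case: (boolP ((k <= 0) || ((horizon I)%:Z < k))) => [out|].
  have -> : at_period X k m = 0; last exact: Pout.
  by case/orP: out; [apply: at_period_le0 | apply: at_period_gt].
case: k => [[|k]|k] //=; rewrite -leNgt lez_nat => ltkn.
rewrite (insubT (fun i => i < horizon I)%N ltkn).
exact: (Pin (Ordinal ltkn)).
Qed.

(** The bound on [k] matters: after the horizon the left side is zero, while the
    window can still contain starts. *)
Lemma at_period_execution (R : realType) (I : instance) (S : assignment R I)
    k m :
  k <= (horizon I)%:Z ->
  at_period (execution S) k m = window (at_period S ^~ m) (duration m) k.
Proof.
elim/at_period_ind: k / (at_period _ k m) => // k /orP[k_le0|k_gt] k_le.
  by rewrite window_eq0 // => i; apply: at_period_le0.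
by lia.
Qed.

Lemma execution_continuous_solution (R : realType) (I : instance)
    (S : assignment R I) :
  continuous_solution (@F6 R) S -> continuous_solution (@F3 R) (execution S).
Proof.
case=> sum1 late S01.
pose a m k := at_period S k m.
have a_ge0 m k : 0 <= a m k.
  rewrite /a; elim/at_period_ind: k / (at_period _ k m) => // t.
  by have := S01 t m; rewrite in_itv => /andP[].
have a_le0 m (k : int) : k <= 0 -> a m k = 0 by apply: at_period_le0.
have a_late m (k : int) :
    (horizon I)%:Z - (duration m)%:Z + 2 <= k -> a m k = 0.
  rewrite /a; elim/at_period_ind: k / (at_period _ k m) => // t.
  exact: late.
have sum_a m : \sum_(t < horizon I) a m t.+1%:Z = 1.
  by rewrite -(sum1 m); apply: eq_bigr => t _; apply: at_period_period.
split=> [m|t m|t m].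
- have -> : \sum_(t < horizon I) execution S t m =
      \sum_(t < horizon I) window (a m) (duration m) t.+1%:Z by [].
  by rewrite (sum_window (a_le0 m) (a_late m)) sum_a.
- have t_le : period t <= (horizon I)%:Z by rewrite /period lez_nat ltn_ord.
  rewrite (at_period_execution S (k := period t - 1)); last by lia.
  rewrite -[execution S t m]/(window (a m) (duration m) (period t)).
  apply: le_trans (window_sub_le _ _ (a_ge0 m)) _.
  (* A start at [t] would end at [t + w - 1], possibly after the horizon. *)
  have [end_le|end_gt] := leP (period t + (duration m)%:Z - 1) (horizon I)%:Z.
    by rewrite at_period_execution // le_window_last // duration_gt0.
  by rewrite at_period_gt // a_late //; lia.
- rewrite -[execution S t m]/(window (a m) (duration m) t.+1%:Z).
  rewrite in_itv /= window_ge0 //=.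
  apply: le_trans (window_le_sum _ _ (a_ge0 m) (a_le0 m)) _.
  rewrite -(sum_a m) -!(big_mkord xpredT (fun i => a m i.+1%:Z)).
  rewrite [leRHS](@big_cat_nat _ _ _ t.+1); [|by []|exact: ltn_ord].
  by rewrite lerDl; apply: sumr_ge0 => i _; apply: a_ge0.
Qed.

Definition two_in_three : instance :=
  @Instance 3 unit (fun=> 2%N) (eq_leq (esym card_unit)) (fun=> isT).

Definition constant_execution (R : realType) : assignment R two_in_three :=
  fun _ _ => 2 / 3.

Lemma constant_execution_F3 (R : realType) :
  continuous_solution (@F3 R) (constant_execution R).
Proof.
split=> [m|t m|t m].
- by rewrite !big_ord_recr big_ord0 /= /constant_execution; lra.
- have c_ge0 : 0 <= 2 / 3 :> R by lra.
  case: t => [[|[|[|//]]] lt_t3] /=; rewrite /constant_execution /=;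
    repeat case: insubP => //= *; lra.
- by rewrite in_itv /= /constant_execution; apply/andP; split; lra.
Qed.

(** Twice [2/3] exceeds the total start weight, which the executions in the
    first and the last period must share. *)
Lemma constant_execution_not_F6 (R : realType) :
  ~ F6_region (constant_execution R).
Proof.
case=> S [[sum1 _ _] execS].
pose a k := at_period S k tt.
have sum_a : a 1 + a 2 + a 3 = 1.
  by rewrite -(sum1 tt) !big_ord_recr big_ord0 /= add0r -!at_period_period.
have exec1 : a 1 = 2 / 3.
  have := execS ord0 tt.
  by rewrite /execution !big_ord_recr big_ord0 /= add0r addr0.
have exec3 : a 3 + a 2 = 2 / 3.
  have := execS ord_max tt.
  by rewrite /execution !big_ord_recr big_ord0 /= add0r.
by lra.
Qed.

Theorem corollary3p3 (R : realType) :
  strictly_tighter (@F6_region R) (@F3_region R).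
Proof.
split=> [I X [S [solS execS]]|].
  have <- : execution S = X by apply/funext => t; apply/funext => m.
  exact: execution_continuous_solution.
exists two_in_three, (constant_execution R).
by split; [apply: constant_execution_F3|apply: constant_execution_not_F6].
Qed.
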